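(* Let $k$ be an algebraically closed field of characteristic zero. The number of finite orbits of a normal infinite correspondence is finite, and it can be bounded as a function of the degree of the correspondence. That is: let $p\in k[X,Y]$ be an irreducible polynomial with $p\notin k[X]\cup k[Y]$, and let $C\subset\mathbb{P}^1\times\mathbb{P}^1$ be the curve associated with it. If $C$ is normal and the correspondence defined by $C$ is infinite (i.e. not finite), then there are only finitely many finite orbits on $C$. Moreover, there is a function $B:\mathbb{N}\times\mathbb{N}\to\mathbb{N}$, not depending on $p$, such that for every such $p$ the number of finite orbits on $C$ is at most $B(\deg_x p,\deg_y p)$.
   Context: $k$ is an algebraically closed field of characteristic zero and $\mathbb{P}^1=\mathbb{P}^1(k)$. For an irreducible $p\in k[X,Y]$ that is neither in $k[X]$ nor in $k[Y]$, write $\deg_x p$, $\deg_y p$ for its degrees in $X$ and $Y$, and let $C\subset\mathbb{P}^1\times\mathbb{P}^1$ be the curve defined by the bi-homogenization $x_0^{\deg_x p}y_0^{\deg_y p}\,p(x_1/x_0,y_1/y_0)$. The curve $C$ is regarded as an algebraic correspondence between two projective lines; $\pi_1,\pi_2:C\to\mathbb{P}^1$ are the projections on the first and second coordinate. For $z\in\mathbb{P}^1$ put $C(z):=\pi_2(\pi_1^{-1}(z))$ and ${}^{\mathrm{tr}}C(z):=\pi_1(\pi_2^{-1}(z))$; these are multivalued maps, extended to subsets of $\mathbb{P}^1$ by taking unions, and composed accordingly. The superscript $(n)$ denotes $n$-fold composition. The correspondence is called finite if there is a positive integer $n$ such that $({}^{\mathrm{tr}}C\circ C)^{(n)}\equiv({}^{\mathrm{tr}}C\circ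 C)^{(n+1)}$ (equality of multivalued maps on $\mathbb{P}^1$), and infinite otherwise. Let $\sim$ be the smallest equivalence relation on (the set of points of) $C$ such that $(z_1,z_2)\sim(w_1,w_2)$ whenever $z_1=w_1$ or $z_2=w_2$. The orbits on $C$ are the equivalence classes of $\sim$; a finite orbit is an orbit that is a finite set. ''Normal'' means that $C$ is normal as an algebraic variety. *)

(* Defs.v *)
From HB Require Import structures.
From Stdlib Require Export Relation_Operators.
From mathcomp Require Export all_boot all_algebra.
From mathcomp Require Export boolp classical_sets functions cardinality.

Set Implicit Arguments.
Unset Strict Implicit.
Unset Printing Implicit Defensive.

Import GRing.Theory.
Local Open Scope ring_scope.
Local Open Scope quotient_scope.

(* Convention for bivariate polynomials, as in polyXY:
   k[X, Y] is {poly {poly k}}, where X is the outer variable 'X and Y is the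
   inner variable 'X%:P; thus p`_i`_j is the coefficient of X^i Y^j. *)

Section ProjectiveLine.
Variable k : fieldType.

Record hcoord := HCoord { hpair :> k * k; _ : hpair != (0, 0) }.
HB.instance Definition _ := [isSub for hpair].
HB.instance Definition _ := [Choice of hcoord by <:].

Definition proportional (v w : hcoord) : bool := v.1 * w.2 == v.2 * w.1.

Lemma proportional_refl : reflexive proportional.
Proof. by move=> v; rewrite /proportional mulrC. Qed.

Lemma proportional_sym : symmetric proportional.
Proof.
by move=> v w; rewrite /proportional eq_sym (mulrC v.2) (mulrC v.1).
Qed.

Lemma proportionalP (v w : hcoord) :
  reflect (exists2 a, a != 0 & w = (a * v.1, a * v.2) :> k * k)
          (proportional v w).
Proof.
rewrite /proportional; case: v w => [[v0 v1] nv] [[w0 w1] nw] /=.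
apply: (iffP eqP) => [e|[a _ [-> ->]]]; last by rewrite mulrCA mulrA mulrC.
have [v00|v0n] := eqVneq v0 0.
  have v1n : v1 != 0.
    by apply: contraNneq nv => v10; rewrite v00 v10.
  have w00 : w0 = 0.
    by apply: (mulfI v1n); rewrite -e v00 mul0r mulr0.
  exists (w1 / v1); last by rewrite v00 mulr0 divfK // w00.
  rewrite mulf_neq0 ?invr_eq0 //.
  by apply: contraNneq nw => w10; rewrite w00 w10.
have ew1 : w1 = w0 / v0 * v1.
  by apply: (mulfI v0n); rewrite e mulrA mulrCA divff // mulr1 mulrC.
exists (w0 / v0); last by rewrite divfK // -ew1.
rewrite mulf_neq0 ?invr_eq0 //.
by apply: contraNneq nw => w00; rewrite ew1 w00 !mul0r.
Qed.

Lemma proportional_trans : transitive proportional.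
Proof.
move=> w v u /proportionalP [a a0 ew] /proportionalP [b b0 eu].
apply/proportionalP; exists (b * a); first by rewrite mulf_neq0.
by rewrite eu ew /= !mulrA.
Qed.

Canonical proportional_equiv :=
  EquivRel proportional proportional_refl proportional_sym proportional_trans.

Definition P1 := {eq_quot proportional}.
HB.instance Definition _ : EqQuotient _ proportional P1 := EqQuotient.on P1.
HB.instance Definition _ := Choice.on P1.

Definition hrepr (z : P1) : k * k := hpair (repr z).

End ProjectiveLine.

Section Curve.
Variable k : fieldType.
Implicit Types p q u v : {poly {poly k}}.

Definition deg_x p : nat := (size p).-1.
Definition deg_y p : nat := (sizeY p).-1.

Definition in_kX p : Prop := exists q : {poly k}, p = map_poly polyC q.
Definition in_kY p : Prop := exists q : {poly k}, p = q%:P.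

(* x0^m y0^n p(x1/x0, y1/y0), for deg_x p <= m and deg_y p <= n. *)
Definition bihom (m n : nat) p (x y : k * k) : k :=
  \sum_(i < m.+1) \sum_(j < n.+1)
    p`_i`_j * (x.1 ^+ (m - i) * x.2 ^+ i) * (y.1 ^+ (n - j) * y.2 ^+ j).

Lemma bihomZ m n p a b (x y : k * k) :
  bihom m n p (a * x.1, a * x.2) (b * y.1, b * y.2) =
  a ^+ m * b ^+ n * bihom m n p x y.
Proof.
rewrite /bihom mulr_sumr; apply: eq_bigr => i _.
rewrite mulr_sumr; apply: eq_bigr => j _ /=; rewrite !exprMn.
have -> : a ^+ m = a ^+ (m - i) * a ^+ i.
  by rewrite -exprD subnK // -ltnS.
have -> : b ^+ n = b ^+ (n - j) * b ^+ j.
  by rewrite -exprD subnK // -ltnS.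
rewrite (mulrACA (a ^+ _) (x.1 ^+ _)) (mulrACA (b ^+ _) (y.1 ^+ _)).
by rewrite (mulrCA p`_i`_j) (mulrACA (_ * _) _ (b ^+ _ * _)).
Qed.

Definition curve p : set (P1 k * P1 k) :=
  [set z | bihom (deg_x p) (deg_y p) p (hrepr z.1) (hrepr z.2) = 0].

(* Membership in the curve can be tested on any homogeneous coordinates. *)
Lemma curveE p (v w : hcoord k) :
  curve p (\pi_(P1 k) v, \pi_(P1 k) w) <->
  bihom (deg_x p) (deg_y p) p v w = 0.
Proof.
rewrite /curve /hrepr /=.
have rep (s : hcoord k) :
    exists2 a, a != 0 & hpair (repr (\pi_(P1 k) s)) = (a * s.1, a * s.2).
  apply/proportionalP; have /eqP := esym (reprK (\pi_(P1 k) s)).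
  by rewrite eqmodE.
have [a a0 ->] := rep v; have [b b0 ->] := rep w.
rewrite bihomZ; split=> [/eqP|->]; last by rewrite mulr0.
by rewrite !mulf_eq0 !expf_eq0 (negPf a0) (negPf b0) !andbF => /eqP.
Qed.

End Curve.

Definition irreducible_elt (R : idomainType) (a : R) : Prop :=
  [/\ a != 0, a \isn't a GRing.unit &
      forall b c : R, a = b * c ->
        (b \is a GRing.unit) \/ (c \is a GRing.unit)].

Section Normality.
Variable k : fieldType.
Implicit Types p q u v : {poly {poly k}}.

(* K, with phi : k[X, Y] -> K, is the fraction field of k[X, Y]/(p).  Such a
   pair (K, phi) exists when p is irreducible, and it is unique up to unique
   isomorphism.  Divisibility is spelled out because %| on {poly {poly k}} is
   pseudo-divisibility, that is, up to factors from k[Y]. *)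
Definition is_function_field p (K : fieldType)
    (phi : {rmorphism {poly {poly k}} -> K}) : Prop :=
  (forall q, phi q = 0 <-> exists r, q = r * p) /\
  (forall f : K, exists u v, phi v != 0 /\ f = phi u / phi v).

(* The local ring at a point z of the curve: quotients of two bihomogeneous
   forms of the same bidegree (m, n) whose denominator does not vanish at z.
   Such forms are the bihomogenizations of polynomials of bidegree at most
   (m, n).  For z on the curve, the condition on v implies phi v != 0. *)
Definition local_ring (K : fieldType) (phi : {rmorphism {poly {poly k}} -> K})
    (z : P1 k * P1 k) : set K :=
  [set f | exists m n u v,
     [/\ (size u <= m.+1)%N /\ (sizeY u <= n.+1)%N,
         (size v <= m.+1)%N /\ (sizeY v <= n.+1)%N,
         bihom m n v (hrepr z.1) (hrepr z.2) != 0 &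
         f = phi u / phi v]].

Definition integral_over (K : fieldType) (A : set K) (f : K) : Prop :=
  exists q : {poly K}, [/\ q \is monic, (forall i, A q`_i) & root q f].

Definition integrally_closed_in (K : fieldType) (A : set K) : Prop :=
  forall f : K, integral_over A f -> A f.

(* All the local rings of the curve are integrally closed in its function
   field. *)
Definition normal_curve p : Prop :=
  forall (K : fieldType) (phi : {rmorphism {poly {poly k}} -> K}),
    is_function_field p phi ->
    forall z, curve p z -> integrally_closed_in (local_ring phi z).

End Normality.

Local Open Scope classical_set_scope.

Definition mv_id (T : Type) : T -> set T := fun z => [set z].

Definition mv_comp (T U V : Type) (g : U -> set V) (f : T -> set U) :
    T -> set V :=
  fun z => \bigcup_(w in f z) g w.

Definition mv_iter (T : Type) (n : nat) (f : T -> set T) : T -> set T :=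
  iter n (mv_comp f) (@mv_id T).

Section Correspondence.
Variable T : Type.
Implicit Type C : set (T * T).

Definition corr C : T -> set T := fun z => snd @` (C `&` fst @^-1` [set z]).
Definition tr_corr C : T -> set T := fun z => fst @` (C `&` snd @^-1` [set z]).

Definition finite_corr C : Prop :=
  exists n : nat, (0 < n)%N /\
    forall z, mv_iter n (mv_comp (tr_corr C) (corr C)) z =
              mv_iter n.+1 (mv_comp (tr_corr C) (corr C)) z.

Definition same_coord C (z w : T * T) : Prop :=
  [/\ C z, C w & z.1 = w.1 \/ z.2 = w.2].

(* For z in C, the class of z under the smallest equivalence relation on C
   that contains same_coord; the class stays inside C because same_coord only
   relates points of C. *)
Definition orbit_of C (z : T * T) : set (T * T) :=
  [set w | clos_refl_sym_trans _ (same_coord C) z w].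

Definition orbits C : set (set (T * T)) := [set orbit_of C z | z in C].

Definition finite_orbits C : set (set (T * T)) :=
  orbits C `&` [set O | finite_set O].

End Correspondence.

(* Main.v *)
Require Import Defs.
From mathcomp Require Import separable ring.
Set Implicit Arguments.
Unset Strict Implicit.
Unset Printing Implicit Defensive.
Import GRing.Theory.
Local Open Scope ring_scope.
Local Open Scope card_scope.
Local Open Scope quotient_scope.
Local Open Scope classical_set_scope.

(** Let m, n be the degrees of p in X and Y.  All but boundedly many finite
    orbits avoid infinity and the points of C where p_x or p_y vanishes; the
    bound comes from the resultants of p with p_x and with p_y.  If such an
    unramified orbit has coordinate sets A and B, then on C the function
      p_y * sum_(a in A) 1/(x - a) + p_x * sum_(b in B) 1/(y - b)
    agrees with a polynomial of bidegree at most (m - 1, n - 1), by a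
    computation with divided differences.  Hence mn + 2 unramified orbits
    satisfy two independent linear relations
      p_y * u_i(x) + p_x * v_i(y) = 0   (i = 1, 2)
    on C, so that u_1/u_2 (x) = v_1/v_2 (y) is a nonconstant function of x alone
    and of y alone.  The orbits of the correspondence are then contained, up to
    a fixed finite set of exceptional points, in fibers of u_1/u_2, which makes
    the correspondence finite.  So there are at most mn + 1 unramified finite
    orbits. *)

(** * Ramification of the projections *)

Section Discriminant.
Variable k : closedFieldType.
Implicit Types (c : {poly k}) (p q g h : {poly {poly k}}) (a b x y : k).

Definition slice p y : {poly k} := map_poly (horner_eval y) p.

Lemma sliceM p q y : slice (p * q) y = slice p y * slice q y.
Proof. exact: rmorphM. Qed.

Lemma sliceD p q y : slice (p + q) y = slice p y + slice q y.
Proof. exact: rmorphD. Qed.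

Lemma slice_deriv p y : slice p^`() y = (slice p y)^`().
Proof. by rewrite /slice deriv_map. Qed.

Lemma coef_slice p y i : (slice p y)`_i = (p`_i).[y].
Proof. by rewrite coef_map. Qed.

Lemma slice_eq0_factor p b :
  slice p b = 0 -> exists g, p = ('X - b%:P) *: g.
Proof.
move=> pb0; have rt i : root p`_i b by rewrite rootE -coef_slice pb0 coef0.
exists (\poly_(i < size p) (p`_i %/ ('X - b%:P))).
apply/polyP => i; rewrite coefZ coef_poly; case: ltnP => [_|ip].
  by apply/esym; rewrite mulrC divpK // dvdp_XsubCl.
by rewrite mulr0 nth_default.
Qed.

(** Gauss's lemma: the linear factors of [c] are cancelled one root at a time. It is needed because
    gcds over k[Y] divide only up to a factor such as [c]; degrees in X survive the cancellation. *)
Lemma gauss_factor c p g h : c != 0 -> c *: p = g * h ->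
  exists g' h', [/\ p = g' * h', size g' = size g & size h' = size h].
Proof.
elim: (size c) {-2}c (leqnn (size c)) g h => [|n IHn] {}c.
  by rewrite leqn0 size_poly_eq0 => ->.
move=> sc g h c0 e.
have [sc1|sc1] := eqVneq (size c) 1%N.
  have /size_poly1P [c1 c1n ec] : size c == 1%N by apply/eqP.
  exists ((c1^-1)%:P *: g), h; split=> //; last first.
    by rewrite size_scale // polyC_eq0 invr_eq0.
  by rewrite -scalerAl -e scalerA ec -polyCM mulVf // scale1r.
have [b rb] : exists b, root c b by apply/closed_rootP.
have [c1 ec] := factor_theorem c b rb.
have c10 : c1 != 0 by apply: contraNneq c0 => z; rewrite ec z mul0r.
have sc1n : (size c1 <= n)%N.
  by move: sc; rewrite ec size_mul ?polyXsubC_eq0 // size_XsubC addn2.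
have Xn0 : 'X - b%:P != 0 :> {poly k} by rewrite polyXsubC_eq0.
have XPn0 : ('X - b%:P)%:P != 0 :> {poly {poly k}} by rewrite polyC_eq0.
(* Modulo Y - b the product of [g] and [h] vanishes and k[X] is a domain, so Y - b divides one of
   them. *)
have : slice g b * slice h b = 0.
  rewrite -sliceM -e; apply/polyP => i.
  by rewrite coef_slice coefZ coef0 hornerM (eqP rb) mul0r.
move/eqP; rewrite mulf_eq0 => /orP [] /eqP /slice_eq0_factor [r er].
- have e1 : c1 *: p = r * h.
    by apply: (mulfI XPn0); rewrite !mul_polyC scalerA mulrC -ec e er scalerAl.
  have [g' [h' [-> sg sh]]] := IHn c1 sc1n r h c10 e1.
  by exists g', h'; split=> //; rewrite er size_scale.
- have e1 : c1 *: p = g * r.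
    by apply: (mulfI XPn0); rewrite !mul_polyC scalerA mulrC -ec e er scalerAr.
  have [g' [h' [-> sg sh]]] := IHn c1 sc1n g r c10 e1.
  by exists g', h'; split=> //; rewrite er size_scale.
Qed.

Lemma size_det_leq n (d : nat) (M : 'M[{poly k}]_n) :
  (forall i j, size (M i j) <= d.+1)%N -> (size (\det M) <= (n * d).+1)%N.
Proof.
move=> sM; rewrite /determinant; apply: leq_trans (size_sum _ _ _) _.
apply/bigmax_leqP => s _.
rewrite mulr_sign (fun_if (fun q : {poly k} => size q)) size_polyN if_same.
apply: leq_trans (size_prod_leq _ _) _.
rewrite leq_subLR addnS ltnS cardT size_enum_ord.
have -> : (n + n * d = \sum_(i < n) d.+1)%N.
  by rewrite sum_nat_const card_ord mulnS.
exact: leq_sum.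
Qed.

Lemma sizeY_deriv p : (sizeY p^`() <= sizeY p)%N.
Proof.
apply/bigmax_leqP => i _; rewrite coef_deriv -scaler_nat.
apply: leq_trans (size_scale_leq _ _) _; exact: max_size_coefXY.
Qed.

(** The order of the Sylvester matrix is the sum of the degrees in X, and its entries are zero or
    coefficients in k[Y] of degree at most [d]. *)
Lemma size_resultant_leq p q (d : nat) : (sizeY p <= d.+1)%N -> (sizeY q <= d.+1)%N ->
  (size (resultant p q) <= (((size q).-1 + (size p).-1) * d).+1)%N.
Proof.
move=> sp sq; apply: size_det_leq => i j; rewrite Sylvester_mxE /=.
by case: (fintype.split _) => l; rewrite mulrb; case: ifP => _; rewrite ?size_poly0 //;
  apply: leq_trans (max_size_coefXY _ _) _.
Qed.

Hypothesis pchar0 : [pchar k] =i pred0.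

Lemma deriv_eq0_size1 p : p^`() = 0 -> (size p <= 1)%N.
Proof.
move=> p'0; rewrite leqNgt; apply/negP => sp.
have p0 : lead_coef p != 0 by rewrite lead_coef_eq0 -size_poly_gt0 ltnW.
have := coef_deriv p (size p).-2; rewrite p'0 coef0.
move: p0; rewrite lead_coefE; case: (size p) sp => [|[|n]] //= _ lp.
move/esym/eqP; rewrite -mulr_natr mulf_eq0 (negPf lp) /=.
by rewrite -polyC_natr polyC_eq0; have /pcharf0P -> := pchar0.
Qed.

(** A zero resultant gives [p] and its X-derivative a pseudo-gcd of positive degree in X. By Gauss's
    lemma [p] has a true factor of that degree, whose cofactor is a unit by irreducibility. The gcd
    then has the degree of [p], too large to divide the nonzero derivative. *)
Lemma irreducible_resultant_neq0 p : irreducible_elt p -> (1 < size p)%N ->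
  resultant p p^`() != 0.
Proof.
move=> [p0 _ irr] sp; rewrite resultant_eq0; apply/negP => sg.
have [[c h] /= c0 e] := Pdiv.WeakIdomain.dvdpP _ _ (dvdp_gcdl p p^`()).
have [h' [g' [ep sh' sg']]] := gauss_factor c0 e.
have p'0 : p^`() != 0.
  by apply/eqP => /deriv_eq0_size1; rewrite leqNgt sp.
have := dvdp_leq p'0 (dvdp_gcdr p p^`()); rewrite leqNgt => /negP; apply.
have sz (u : {poly {poly k}}) : u \is a GRing.unit -> size u = 1%N.
  by rewrite poly_unitE => /andP [/eqP ->].
case: (irr _ _ ep) => /sz s1; last by rewrite -sg' s1 in sg.
have : size p = size g'.
  have /andP [h'0 g'0] : (h' != 0) && (g' != 0).
    by move: p0; rewrite ep mulf_eq0 negb_or.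
  by rewrite ep size_mul // s1.
by rewrite sg' => <-; rewrite lt_size_deriv.
Qed.

(** The resultant of p and p_x is a nonzero polynomial in Y of degree at most (2m - 1)n. It lies in
    the ideal they generate, so it vanishes at the Y-coordinate of each common zero. *)
Lemma ramification_bound p : irreducible_elt p -> (1 < size p)%N ->
  exists2 s : seq k, (size s <= (2 * deg_x p) * deg_y p)%N &
    forall x y, (slice p y).[x] = 0 -> (slice p y)^`().[x] = 0 -> y \in s.
Proof.
move=> irr sp.
have p0 : p != 0 by rewrite -size_poly_gt0 ltnW.
have sYp : sizeY p = (deg_y p).+1.
  by rewrite /deg_y prednK // lt0n sizeY_eq0.
have sYp' : (sizeY p^`() <= (deg_y p).+1)%N by rewrite -sYp sizeY_deriv.
have m0 : (0 < deg_x p)%N by rewrite /deg_x -subn1 subn_gt0.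
suff [r [r0 sr zr]] : exists r : {poly k}, [/\ r != 0,
    (size r <= ((2 * deg_x p) * deg_y p).+1)%N &
    forall x y, (slice p y).[x] = 0 -> (slice p y)^`().[x] = 0 -> root r y].
  have [s er] := closed_field_poly_normal r; exists s => [|x y pxy p'xy].
    by move: sr; rewrite {1}er size_scale ?lead_coef_eq0 // size_prod_XsubC.
  have := zr _ _ pxy p'xy.
  by rewrite er rootZ ?lead_coef_eq0 // root_prod_XsubC.
have [sp'1|s1] := ltnP 1 (size p^`()).
  exists (resultant p p^`()); split; first exact: irreducible_resultant_neq0.
    have sYp1 : (sizeY p <= (deg_y p).+1)%N by rewrite sYp.
    apply: leq_trans (size_resultant_leq sYp1 sYp') _.
    rewrite ltnS leq_mul2r /deg_x mul2n -addnn leq_add2r -!subn1 leq_sub2r //.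
      by rewrite orbT.
    by rewrite ltnW // lt_size_deriv.
  move=> x y pxy p'xy.
  have [[u v] /= _ e] := resultant_in_ideal sp sp'1.
  have := congr1 (fun q => (slice q y).[x]) e.
  rewrite sliceD !sliceM slice_deriv hornerD !hornerM pxy p'xy !mulr0 addr0.
  by rewrite /slice map_polyC hornerC /= => /eqP.
(* When p_x does not involve X, it lies in k[Y] itself and takes the place of the resultant. *)
have [c e] : exists c, p^`() = c%:P.
  by exists p^`()`_0; apply: size1_polyC.
exists c; split=> [||x y _].
- apply: contraTneq sp => c0; rewrite -leqNgt; apply: deriv_eq0_size1.
  by rewrite e c0.
- apply: leq_trans (_ : _ <= (deg_y p).+1)%N _.
    by apply: leq_trans sYp'; have := max_size_coefXY p^`() 0; rewrite e coefC.
  by rewrite ltnS leq_pmull // muln_gt0.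
by rewrite -slice_deriv e /slice map_polyC hornerC /= => /eqP.
Qed.
End Discriminant.

(** * Unramified grids *)

Lemma horner_deriv_prod_XsubC (k : fieldType) (s : seq k) (y : k) : y \notin s ->
  (\prod_(z <- s) ('X - z%:P))^`().[y] =
  \sum_(z <- s) (\prod_(z <- s) ('X - z%:P)).[y] / (y - z).
Proof.
elim: s => [|z s IHs]; first by rewrite !big_nil derivC horner0.
rewrite inE negb_or => /andP [yz /IHs e]; rewrite !big_cons derivM.
rewrite derivXsubC mul1r hornerD !hornerM !hornerXsubC e mulrAC divff ?subr_eq0 //.
rewrite mul1r; congr (_ + _); rewrite mulr_sumr; apply: eq_bigr => w _.
by rewrite mulrA.
Qed.

(** This is the expansion of f'/f over simple roots, multiplied by f(y). The list [s] may contain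
    more than the roots, hence the filter in the sum. *)
Lemma logarithmic_deriv (k : closedFieldType) (f : {poly k}) (s : seq k) (y : k) :
    uniq s -> (forall b, root f b -> b \in s /\ f^`().[b] != 0) -> y \notin s ->
  f^`().[y] = \sum_(b <- s | root f b) f.[y] / (y - b).
Proof.
move=> us rf ys.
have f0 : f != 0.
  apply/eqP => z; have := rf 0; rewrite z root0 => /(_ isT) [_].
  by rewrite derivC horner0 eqxx.
have [r er] := closed_field_poly_normal f; set c := lead_coef f in er.
have c0 : c != 0 by rewrite lead_coef_eq0.
have mr b : root f b = (b \in r) by rewrite er rootZ // root_prod_XsubC.
have ur : uniq r.
  rewrite -separable_prod_XsubC separable_poly.unlock; apply/Pdiv.ClosedField.coprimepP => b.
  rewrite root_prod_XsubC -mr => /rf [_]; rewrite er derivZ hornerZ mulf_eq0.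
  by rewrite negb_or => /andP [].
have pr : perm_eq r [seq b <- s | root f b].
  apply: uniq_perm => //; first exact: filter_uniq.
  by move=> b; rewrite mem_filter -mr; case: (boolP (root f b)) => // /rf [->].
rewrite -big_filter -(perm_big _ pr) /= er derivZ !hornerZ.
rewrite horner_deriv_prod_XsubC; last by rewrite -mr; apply: contra ys => /rf [].
by rewrite mulr_sumr; apply: eq_bigr => b _; rewrite mulrA.
Qed.

Section Grid.
Variables (k : closedFieldType) (p : {poly {poly k}}).
Local Notation m := (deg_x p).
Local Notation n := (deg_y p).
Implicit Types (x y a b : k) (phi psi : nat -> k).

(** Values, partial derivatives and divided differences of p, taken independently in the two
    variables, all have this form. *)
Definition pairing phi psi : k :=
  \sum_(i < m.+1) \sum_(j < n.+1) p`_i`_j * phi i * psi j.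

Definition monomials x : nat -> k := fun i => x ^+ i.
Definition dmonomials x : nat -> k := fun i => x ^+ i.-1 *+ i.
(** The quotient (x^i - a^i)/(x - a), expanded so that it is visibly a polynomial in x. *)
Definition divided_diff x a : nat -> k :=
  fun i => \sum_(l < i) x ^+ (i.-1 - l) * a ^+ l.

Lemma divided_diffE x a i :
  monomials x i - monomials a i = (x - a) * divided_diff x a i.
Proof. exact: subrXX. Qed.

Lemma pairing_diff_l x a psi : pairing (monomials x) psi =
  pairing (monomials a) psi + (x - a) * pairing (divided_diff x a) psi.
Proof.
rewrite /pairing mulr_sumr -big_split; apply: eq_bigr => i _ /=.
rewrite mulr_sumr -big_split; apply: eq_bigr => j _ /=.
rewrite -[monomials x i](subrK (monomials a i)) divided_diffE.
by ring.
Qed.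

Lemma pairing_diff_r y b phi : pairing phi (monomials y) =
  pairing phi (monomials b) + (y - b) * pairing phi (divided_diff y b).
Proof.
rewrite /pairing mulr_sumr -big_split; apply: eq_bigr => i _ /=.
rewrite mulr_sumr -big_split; apply: eq_bigr => j _ /=.
rewrite -[monomials y j](subrK (monomials b j)) divided_diffE.
by ring.
Qed.

(* [specY y] is p(X, y) and [specX x] is p(x, Y). *)
Definition specY y : {poly k} := slice p y.
Definition specX x : {poly k} := slice (swapXY p) x.

Lemma size_coef_leq i : (size (p`_i)%R <= n.+1)%N.
Proof. exact: leq_trans (max_size_coefXY _ _) (leqSpred _). Qed.

Lemma size_specY y : (size (specY y) <= m.+1)%N.
Proof. exact: leq_trans (size_poly _ _) (leqSpred _). Qed.

Lemma size_specX x : (size (specX x) <= n.+1)%N.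
Proof. by apply: leq_trans (size_poly _ _) _; rewrite -sizeYE leqSpred. Qed.

Lemma coef_specY y i : (specY y)`_i = \sum_(j < n.+1) p`_i`_j * y ^+ j.
Proof. by rewrite coef_slice (horner_coef_wide _ (size_coef_leq i)). Qed.

Lemma coef_specX x j : (specX x)`_j = \sum_(i < m.+1) p`_i`_j * x ^+ i.
Proof.
rewrite coef_slice (@horner_coef_wide _ m.+1); last first.
  apply: leq_trans (max_size_coefXY _ _) _; rewrite sizeYE swapXYK; exact: leqSpred.
by apply: eq_bigr => i _; rewrite coef_swapXY.
Qed.

Lemma horner_specY x y : (specY y).[x] = pairing (monomials x) (monomials y).
Proof.
rewrite (horner_coef_wide _ (size_specY y)); apply: eq_bigr => i _.
by rewrite coef_specY mulr_suml; apply: eq_bigr => j _; rewrite mulrAC.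
Qed.

Lemma horner_specX x y : (specX x).[y] = pairing (monomials x) (monomials y).
Proof.
rewrite (horner_coef_wide _ (size_specX x)) /pairing exchange_big.
by apply: eq_bigr => j _; rewrite coef_specX mulr_suml.
Qed.

Lemma horner_deriv_wide (f : {poly k}) d x : (size f <= d.+1)%N ->
  f^`().[x] = \sum_(i < d.+1) f`_i * dmonomials x i.
Proof.
move=> sf; rewrite (@horner_coef_wide _ d); last first.
  have [->|f0] := eqVneq f 0; first by rewrite derivC size_poly0.
  by rewrite -ltnS (leq_trans (lt_size_deriv f0)).
rewrite big_ord_recl /dmonomials mulr0n mulr0 add0r.
by apply: eq_bigr => i _; rewrite coef_deriv /= mulrnAl mulrnAr.
Qed.

Lemma horner_deriv_specY x y :
  (specY y)^`().[x] = pairing (dmonomials x) (monomials y).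
Proof.
rewrite (horner_deriv_wide _ (size_specY y)); apply: eq_bigr => i _.
by rewrite coef_specY mulr_suml; apply: eq_bigr => j _; rewrite mulrAC.
Qed.

Lemma horner_deriv_specX x y :
  (specX x)^`().[y] = pairing (monomials x) (dmonomials y).
Proof.
rewrite (horner_deriv_wide _ (size_specX x)) /pairing exchange_big.
by apply: eq_bigr => j _; rewrite coef_specX mulr_suml.
Qed.

(** A model of the coordinate sets of an unramified finite orbit: no affine point of the curve has
    exactly one coordinate in the grid. *)
Definition unramified_grid (A B : seq k) : Prop :=
  [/\ uniq A, uniq B,
      forall x y, (specX x).[y] = 0 -> (x \in A) = (y \in B) &
      forall x y, (specX x).[y] = 0 -> x \in A ->
        (specX x)^`().[y] != 0 /\ (specY y)^`().[x] != 0].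

Definition remainder (A B : seq k) x y : k :=
  \sum_(a <- A) pairing (divided_diff x a) (dmonomials y)
  - \sum_(a <- A) \sum_(b <- B | root (specX a) b)
      pairing (divided_diff x a) (divided_diff y b)
  + \sum_(b <- B) pairing (dmonomials x) (divided_diff y b).

Lemma root_specX_specY x y : root (specX x) y = root (specY y) x.
Proof. by rewrite !rootE horner_specX horner_specY. Qed.

(** Expand p_y(x, y)/(x - a) around a and p_x(x, y)/(y - b) around b. The logarithmic derivatives of
    p(a, Y) and p(X, b) produce the polar terms p(x, b)/((x - a)(y - b)), one for each curve point
    (a, b) of the grid. These occur with opposite signs and cancel; [remainder] is what is left. *)
Lemma grid_identity A B x y : unramified_grid A B ->
    (specX x).[y] = 0 -> x \notin A -> y \notin B ->
  (specX x)^`().[y] * \sum_(a <- A) (x - a)^-1 +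
  (specY y)^`().[x] * \sum_(b <- B) (y - b)^-1 = remainder A B x y.
Proof.
move=> [uA uB AB ram] pxy xA yB.
have drow a : a \in A ->
    (specX a)^`().[y] = \sum_(b <- B | root (specX a) b) (specX a).[y] / (y - b).
  move=> aA; apply: logarithmic_deriv => // b /rootP rb.
  by rewrite -(AB _ _ rb); case: (ram a b rb aA).
have dcol b : b \in B ->
    (specY b)^`().[x] = \sum_(a <- A | root (specY b) a) (specY b).[x] / (x - a).
  move=> bB; apply: logarithmic_deriv => // a; rewrite -root_specX_specY => /rootP ra.
  have aA : a \in A by rewrite (AB _ _ ra).
  by case: (ram a b ra aA).
have xa a : a \in A -> x - a != 0.
  by move=> aA; rewrite subr_eq0; apply: contraNneq xA => ->.
have yb b : b \in B -> y - b != 0.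
  by move=> bB; rewrite subr_eq0; apply: contraNneq yB => ->.
(* On the curve p(a, y) = - (x - a) q_a(x, y) for the divided difference q_a of p
   in X, and the logarithmic derivative of p(a, Y) has its poles in B. *)
have step_a a : a \in A -> (specX x)^`().[y] / (x - a) =
    pairing (divided_diff x a) (dmonomials y)
    - \sum_(b <- B | root (specX a) b) pairing (divided_diff x a) (divided_diff y b)
    - \sum_(b <- B | root (specX a) b) (specY b).[x] / (x - a) / (y - b).
  move=> aA; have xa0 := xa _ aA.
  rewrite horner_deriv_specX (pairing_diff_l x a) mulrDl mulrAC divff // mul1r.
  rewrite addrC -addrA; congr (_ + _); rewrite -horner_deriv_specX drow //.
  rewrite mulr_suml -!sumrN -big_split big_seq_cond [RHS]big_seq_cond.
  apply: eq_bigr => b /andP [bB rab] /=; have yb0 := yb _ bB.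
  have eay : (specX a).[y] = - (x - a) * pairing (divided_diff x a) (monomials y).
    have := horner_specX x y; rewrite pxy (pairing_diff_l x a) -horner_specX.
    by move/eqP; rewrite eq_sym addr_eq0 mulNr => /eqP.
  have ecb : (specY b).[x] = (x - a) * pairing (divided_diff x a) (monomials b).
    rewrite horner_specY (pairing_diff_l x a) -horner_specX.
    by rewrite (rootP rab) add0r.
  rewrite eay ecb (pairing_diff_r y b); set u := pairing _ _; set v := pairing _ _.
  by field; rewrite xa0 yb0.
(* The expansion in the other variable yields the polar terms of [step_a] with the opposite sign. *)
have step_b b : b \in B -> (specY y)^`().[x] / (y - b) =
    pairing (dmonomials x) (divided_diff y b) +
    \sum_(a <- A | root (specX a) b) (specY b).[x] / (x - a) / (y - b).
  move=> bB; have yb0 := yb _ bB.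
  rewrite horner_deriv_specY (pairing_diff_r y b) -horner_deriv_specY mulrDl.
  rewrite addrC mulrAC divff // mul1r dcol // mulr_suml; congr (_ + _).
  by apply: eq_bigl => a; rewrite root_specX_specY.
rewrite !mulr_sumr (eq_big_seq _ step_a) (eq_big_seq _ step_b).
rewrite !big_split /= !sumrN /remainder -!addrA; do 2!congr (_ + _).
rewrite addrCA; rewrite -[RHS]addr0; congr (_ + _).
rewrite (exchange_big_dep xpredT) //= addrC; apply/eqP; rewrite subr_eq0; apply/eqP.
by apply: eq_bigr => b _; apply: eq_bigl => a.
Qed.

(** Bidegree at most (m - 1, n - 1). The coefficients form a matrix, so that dependence among such
    functions becomes a rank question in dimension mn. *)
Definition biform (f : k -> k -> k) : Prop :=
  exists M : 'M[k]_(m, n), forall x y,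
    f x y = \sum_i \sum_j M i j * x ^+ i * y ^+ j.

Lemma biform0 : biform (fun _ _ => 0).
Proof.
exists 0 => x y; rewrite big1 // => i _; rewrite big1 // => j _.
by rewrite mxE !mul0r.
Qed.

Lemma biformD f g : biform f -> biform g -> biform (fun x y => f x y + g x y).
Proof.
move=> [M fM] [N gN]; exists (M + N) => x y; rewrite fM gN -big_split.
apply: eq_bigr => i _ /=; rewrite -big_split; apply: eq_bigr => j _ /=.
by rewrite mxE !mulrDl.
Qed.

Lemma biformZ c f : biform f -> biform (fun x y => c * f x y).
Proof.
move=> [M fM]; exists (c *: M) => x y; rewrite fM mulr_sumr.
apply: eq_bigr => i _ /=; rewrite mulr_sumr; apply: eq_bigr => j _ /=.
by rewrite mxE !mulrA.
Qed.

Lemma biform_sum (I : Type) (r : seq I) (P : pred I) (F : I -> k -> k -> k) :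
  (forall i, biform (F i)) -> biform (fun x y => \sum_(i <- r | P i) F i x y).
Proof.
move=> bF; elim: r => [|i r [M eM]].
  by have [M eM] := biform0; exists M => x y; rewrite big_nil.
have [Pi|nPi] := boolP (P i); last first.
  by exists M => x y; rewrite big_cons (negPf nPi).
have [N eN] := biformD (bF i) (ex_intro _ M eM).
by exists N => x y; rewrite big_cons Pi.
Qed.

Lemma biform_mul (f g : {poly k}) : (size f <= m)%N -> (size g <= n)%N ->
  biform (fun x y => f.[x] * g.[y]).
Proof.
move=> sf sg; exists (\matrix_(i, j) (f`_i * g`_j)) => x y.
rewrite (horner_coef_wide _ sf) (horner_coef_wide _ sg) mulr_suml.
apply: eq_bigr => i _; rewrite mulr_sumr; apply: eq_bigr => j _.
by rewrite mxE; ring.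
Qed.

Lemma biform_pairing (phi psi : k -> nat -> k) :
    (forall i, (i <= m)%N -> exists2 f : {poly k}, (size f <= m)%N &
       forall x, phi x i = f.[x]) ->
    (forall j, (j <= n)%N -> exists2 g : {poly k}, (size g <= n)%N &
       forall y, psi y j = g.[y]) ->
  biform (fun x y => pairing (phi x) (psi y)).
Proof.
move=> pphi ppsi; apply: biform_sum => i; apply: biform_sum => j.
have [f sf ef] := pphi i (leq_ord i); have [g sg eg] := ppsi j (leq_ord j).
have [M eM] := biformZ p`_i`_j (biform_mul sf sg).
by exists M => x y; rewrite -eM ef eg mulrA.
Qed.

Lemma dmonomials_poly d i : (i <= d)%N -> exists2 f : {poly k}, (size f <= d)%N &
  forall x, dmonomials x i = f.[x].
Proof.
case: i => [|i] id; first by exists 0; rewrite ?size_poly0 // => x; rewrite horner0.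
exists ('X^i *+ i.+1) => [|x]; last by rewrite hornerMn hornerXn.
rewrite -scaler_nat; apply: leq_trans (size_scale_leq _ _) _.
by rewrite size_polyXn.
Qed.

Lemma divided_diff_poly a d i : (i <= d)%N ->
  exists2 f : {poly k}, (size f <= d)%N & forall x, divided_diff x a i = f.[x].
Proof.
move=> id; exists (\sum_(l < i) a ^+ l *: 'X^(i.-1 - l)) => [|x].
  apply: leq_trans (size_sum _ _ _) _; apply/bigmax_leqP => l _.
  apply: leq_trans (size_scale_leq _ _) _; rewrite size_polyXn.
  by case: i id l => [|i] id [] // l _ /=; apply: leq_ltn_trans (leq_subr _ _) id.
rewrite horner_sum; apply: eq_bigr => l _.
by rewrite hornerZ hornerXn mulrC.
Qed.

(** Each pairing in [remainder] has a derivative or a divided difference in both variables, and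
    either one lowers the degree by one. *)
Lemma biform_remainder A B : biform (remainder A B).
Proof.
apply: biformD; first apply: biformD.
- apply: biform_sum => a; apply: biform_pairing => i.
    exact: divided_diff_poly.
  exact: dmonomials_poly.
- pose g x y := \sum_(a <- A) \sum_(b <- B | root (specX a) b)
    pairing (divided_diff x a) (divided_diff y b).
  have [M eM] : biform (fun x y => -1 * g x y).
    apply: biformZ; apply: biform_sum => a; apply: biform_sum => b.
    by apply: biform_pairing => i; apply: divided_diff_poly.
  by exists M => x y; rewrite -eM mulN1r.
- apply: biform_sum => b; apply: biform_pairing => i.
    exact: dmonomials_poly.
  exact: divided_diff_poly.
Qed.

(** At least mn + 2 vectors in dimension mn have two independent linear relations. These annihilate
    the remainders, and [grid_identity] converts them into relations on the curve. *)
Lemma linear_relations r (A B : 'I_r -> seq k) : (m * n + 1 < r)%N ->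
    (forall i, unramified_grid (A i) (B i)) ->
  exists c d : 'I_r -> k,
    (forall s t, (forall i, s * c i + t * d i = 0) -> s = 0 /\ t = 0) /\
    forall x y, (specX x).[y] = 0 -> (forall i, x \notin A i) ->
      (forall i, y \notin B i) -> forall e, e = c \/ e = d ->
    (specX x)^`().[y] * (\sum_i e i * \sum_(a <- A i) (x - a)^-1) +
    (specY y)^`().[x] * (\sum_i e i * \sum_(b <- B i) (y - b)^-1) = 0.
Proof.
move=> lt_r grid.
have [M eM] := boolp.choice (fun l => biform_remainder (A l) (B l)).
pose N := \matrix_l mxvec (M l).
have rk : (1 < \rank (kermx N))%N.
  rewrite mxrank_ker ltn_subRL; apply: leq_ltn_trans lt_r.
  by rewrite leq_add2r rank_leq_col.
pose i0 := Ordinal (ltnW rk); pose i1 := Ordinal rk.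
(* The rows of [K] are a basis of the left kernel of [N]; two of them serve as [c] and [d]. *)
have [K KN freeK] : exists2 K : 'M_(\rank (kermx N), r), K *m N = 0 & row_free K.
  exists (row_base (kermx N)); last exact: row_base_free.
  by apply/sub_kermxP; rewrite eq_row_base.
exists (K i0), (K i1); split=> [s t z|x y pxy xA yB e ee].
  have : s *: delta_mx 0 i0 + t *: delta_mx 0 i1 = 0 :> 'rV_(\rank (kermx N)).
    apply: (row_free_inj freeK); rewrite mul0mx mulmxDl.
    rewrite -!scalemxAl -!rowE; apply/rowP => i.
    by rewrite !mxE; exact: z.
  move/rowP => z'; have := z' i0; have := z' i1.
  by rewrite !mxE !eqxx /= !mulr1 !mulr0 addr0 add0r.
pose v := \row_i e i.
have vN : v *m N = 0.
  have rowK i : row i K *m N = 0 by rewrite -row_mul KN row0.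
  have [ev|ev] : v = row i0 K \/ v = row i1 K.
  - by case: ee => ee; [left|right]; apply/rowP => i; rewrite !mxE ee.
  - by rewrite ev rowK.
  - by rewrite ev rowK.
have vM : \sum_l e l *: M l = 0.
  apply: (can_inj mxvecK); rewrite linear_sum linear0.
  apply/rowP => j; transitivity ((v *m N) 0 j); last by rewrite vN.
  rewrite summxE [RHS]mxE; apply: eq_bigr => l _.
  by rewrite linearZ !mxE.
rewrite !mulr_sumr -big_split /=.
transitivity (\sum_l e l * remainder (A l) (B l) x y).
  apply: eq_bigr => l _; rewrite -grid_identity // mulrDr.
  by congr (_ + _); rewrite mulrCA.
transitivity (\sum_i \sum_j (\sum_l e l *: M l) i j * x ^+ i * y ^+ j).
  under eq_bigr do rewrite eM mulr_sumr.
  rewrite exchange_big; apply: eq_bigr => i _ /=.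
  under eq_bigr do rewrite mulr_sumr.
  rewrite exchange_big; apply: eq_bigr => j _ /=.
  rewrite summxE !mulr_suml; apply: eq_bigr => l _.
  by rewrite mxE !mulrA.
by rewrite vM big1 // => i _; rewrite big1 // => j _; rewrite mxE !mul0r.
Qed.

End Grid.

(** After clearing denominators the numerator is nonzero: at a root of [F i] with [c i] nonzero,
    only the i-th summand survives. The bound [D] is chosen before [c], which later bounds all
    fibers uniformly. *)
Lemma partial_fraction_zeros (k : closedFieldType) r (A : 'I_r -> seq k) :
    (forall i, uniq (A i)) -> (forall i, A i != [::]) ->
    (forall i j a, a \in A i -> a \in A j -> i = j) ->
  exists D : nat, forall c : 'I_r -> k, (exists i, c i != 0) ->
    exists2 s : seq k, (size s <= D)%N & forall x, (forall i, x \notin A i) ->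
      \sum_i c i * (\sum_(a <- A i) (x - a)^-1) = 0 -> x \in s.
Proof.
move=> uA nA dA; pose F i := \prod_(z <- A i) ('X - z%:P).
pose G i := (F i)^`() * \prod_(j | j != i) F j.
exists (\max_i size (G i)) => c [i ci].
pose f := \sum_i c i *: G i.
have [a aAi] : exists a, a \in A i.
  by case: (A i) (nA i) => // a s _; exists a; rewrite mem_head.
have Fa j : root (F j) a = (j == i).
  rewrite root_prod_XsubC; apply/idP/eqP => [/(dA _ _ _ aAi) //|-> //].
have F'a : (F i)^`().[a] != 0.
  have : separable_poly (F i) by rewrite separable_prod_XsubC.
  rewrite separable_poly.unlock => /Pdiv.ClosedField.coprimepP; apply.
  by rewrite Fa.
have fa : f.[a] != 0.
  rewrite /f horner_sum (bigD1 i) //= big1 ?addr0 => [|j ji].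
    rewrite hornerZ mulf_neq0 // hornerM mulf_neq0 // horner_prod.
    by apply/prodf_neq0 => j ji; rewrite -rootE Fa.
  rewrite hornerZ hornerM horner_prod (bigD1 i) 1?eq_sym //=.
  have /rootP -> : root (F i) a by rewrite Fa.
  by rewrite mul0r !mulr0.
have f0 : f != 0 by apply: contraNneq fa => ->; rewrite horner0.
have [s es] := closed_field_poly_normal f; exists s => [|x xA ux].
  rewrite -ltnS -(size_prod_XsubC s idfun) -(size_scale _ (_ : lead_coef f != 0)).
    rewrite -es; apply: leqW; apply: leq_trans (size_sum _ _ _) _; apply/bigmax_leqP => j _.
    by apply: leq_trans (size_scale_leq _ _) _; apply: leq_bigmax.
  by rewrite lead_coef_eq0.
suff : root f x by rewrite es rootZ ?lead_coef_eq0 // root_prod_XsubC.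
rewrite rootE horner_sum; apply/eqP.
(* Multiplying by all [F j] turns each sum of 1/(x - a) into the derivative of [F i] times the other
   factors. *)
transitivity ((\prod_j F j).[x] * \sum_i c i * (\sum_(a <- A i) (x - a)^-1)).
  rewrite mulr_sumr; apply: eq_bigr => j _.
  rewrite hornerZ hornerM [in RHS](bigD1 j) //= hornerM horner_deriv_prod_XsubC //.
  rewrite -mulr_sumr; ring.
by rewrite ux mulr0.
Qed.

(** * Iteration and counting; points of the curve *)

Section Stabilization.
Variables (T : choiceType) (R : T -> set T).
Hypothesis Rrefl : forall z x, R z x -> R z z /\ R x x.

Lemma mv_iterS n z x : mv_iter n.+1 R z x <-> exists2 w, mv_iter n R z w & R w x.
Proof. by split=> -[w ? ?]; exists w. Qed.

Lemma mv_iter_mono n z : R z z -> mv_iter n R z `<=` mv_iter n.+1 R z.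
Proof.
move=> zz x zx; apply/mv_iterS; exists x => //.
case: n zx => [->//|n /mv_iterS [w _ /Rrefl []]] //.
Qed.

(** By [Rrefl] such a [z] has no image at all. The zeroth iterate is still {z}, so stabilization can
    only be claimed from the first iterate on. *)
Lemma mv_iter_empty n z : ~ R z z -> mv_iter n.+1 R z = set0.
Proof.
move=> zz; elim: n => [|n IHn]; apply/seteqP; split=> // x /mv_iterS [w].
  by move=> -> /Rrefl [].
by rewrite IHn.
Qed.

(** The iterates increase inside the closed set [Z], and once two consecutive ones agree they stay
    constant. Strict growth can last for at most [size s] steps. *)
Lemma mv_iter_stable (Z : set T) (s : seq T) N z : R z z -> (size s <= N)%N -> Z z ->
    (forall t x, Z t -> R t x -> Z x) -> (forall t, Z t -> t \in s) ->
  mv_iter N R z = mv_iter N.+1 R z.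
Proof.
move=> zz sN Zz Zc Zs.
have subZ n t : mv_iter n R z t -> Z t.
  elim: n t => [|n IHn] t; first by move=> ->.
  by case/mv_iterS => w /IHn; apply: Zc.
pose c n := count (fun t => `[< mv_iter n R z t >]) (undup s).
have cle n : (c n <= size s)%N.
  exact: leq_trans (count_size _ _) (size_undup _).
have grow n : mv_iter n R z <> mv_iter n.+1 R z -> (c n < c n.+1)%N.
  move=> ne; have [t [t1 t0]] : exists t, mv_iter n.+1 R z t /\ ~ mv_iter n R z t.
    apply: contrapT => no; apply: ne; apply/seteqP; split=> [|t tS].
      exact: mv_iter_mono.
    by apply: contrapT => tn; apply: no; exists t.
  rewrite /c -!size_filter; set f0 := filter _ _; set f1 := filter _ _.
  suff : (size (t :: f0) <= size f1)%N by [].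
  apply: uniq_leq_size => [|x].
    rewrite /= mem_filter; apply/andP; split; last exact: filter_uniq (undup_uniq s).
    by apply/negP => /andP [/asboolP].
  rewrite inE => /predU1P [->|].
    by rewrite mem_filter mem_undup; apply/andP; split; [apply/asboolP|apply/Zs/subZ/t1].
  rewrite !mem_filter => /andP [/asboolP xn ->]; rewrite andbT.
  by apply/asboolP/mv_iter_mono.
have stable n : mv_iter n R z = mv_iter n.+1 R z ->
    forall d, mv_iter (n + d) R z = mv_iter (n + d).+1 R z.
  move=> e; elim=> [|d IHd]; first by rewrite addn0.
  by rewrite addnS; apply/seteqP; split=> x /mv_iterS [w zw wx]; apply/mv_iterS;
    exists w => //; move: zw; rewrite IHd.
have [[n [nN e]]|no] := pselect (exists n, (n <= N)%N /\
    mv_iter n R z = mv_iter n.+1 R z).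
  by rewrite -(subnKC nN); apply: stable.
(* Without stabilization every step adds a point, so the iterate of index N + 1 would have more
   points than [s]. *)
have : forall n, (n <= N.+1)%N -> (n <= c n)%N.
  elim=> // n IHn nN; apply: leq_ltn_trans (IHn (ltnW nN)) _.
  by apply: grow => e; apply: no; exists n; split.
move=> /(_ N.+1 (leqnn _)) cN; have := leq_trans cN (cle _).
by rewrite ltnNge sN.
Qed.

(** Away from [E] the relation stays inside classes of at most [D] points. Passing through [E] can
    merge classes, but only the finitely many that contain images of [E]. *)
Lemma merged_classes_bounded (eqv : T -> T -> Prop) (E : seq T) (D : nat) :
    (forall x, x \notin E -> eqv x x) ->
    (forall x y z, eqv x y -> eqv y z -> eqv x z) ->
    (forall x y, x \notin E -> y \notin E -> R x y -> eqv x y) ->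
    (forall x, x \notin E -> exists2 s : seq T, (size s <= D)%N &
       forall y, y \notin E -> eqv x y -> y \in s) ->
    (forall e, exists s : seq T, forall x, R e x -> x \in s) ->
  exists N, forall z, mv_iter N.+1 R z = mv_iter N.+2 R z.
Proof.
move=> eqvxx eqvT Reqv classE Rfin.
have /boolp.choice [F FP] : forall x, exists s : seq T, (size s <= D)%N /\
    (x \notin E -> forall y, y \notin E -> eqv x y -> y \in s).
  move=> x; have [xE|/classE [s sD sP]] := boolP (x \in E).
    by exists [::].
  by exists s; split.
have [N NP] := boolp.choice Rfin.
(* [W] lists the classes of the images of [E]. It does not depend on [z], so neither does the final
   index. *)
pose W := flatten [seq flatten [seq F x | x <- N e] | e <- E].
exists (size E + D + size W)%N => z.
have [zz|zz] := pselect (R z z); last by rewrite !mv_iter_empty.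
(* The closed set around [z]: the exceptional points, the class of [z], and the classes entered from
   [E]. *)
pose Z t := t \in E \/ t \notin E /\ (z \notin E /\ eqv z t \/
  exists e x, [/\ e \in E, R e x, x \notin E & eqv x t]).
apply: (@mv_iter_stable Z (E ++ F z ++ W)) => //.
- by apply: leqW; rewrite !size_cat -addnA leq_add2l leq_add2r; case: (FP z).
- by have [zE|zE] := boolP (z \in E); [left|right; split=> //; left; split=> //; apply: eqvxx].
- move=> t x Zt tx; have [xE|xE] := boolP (x \in E); first by left.
  right; split=> //; case: Zt => [tE|[tE [[zE zt]|[e [y [eE ey yE yt]]]]]].
  + by right; exists t, x; split=> //; apply: eqvxx.
  + by left; split=> //; apply: eqvT zt _; apply: Reqv.
  + by right; exists e, y; split=> //; apply: eqvT yt _; apply: Reqv.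
- move=> t; rewrite !mem_cat; case=> [->//|[tE [[zE zt]|[e [y [eE ey yE yt]]]]]].
  + by have [_ ->] := FP z; rewrite ?orbT.
  + apply/orP; right; apply/orP; right; apply/flattenP.
    exists (flatten [seq F x | x <- N e]); first exact: map_f.
    apply/flattenP; exists (F y); first by apply: map_f; apply: NP.
    by have [_ ->] := FP y.
Qed.

End Stabilization.

(** * Counting by labels and by duplicate-free lists *)

Section Counting.
Variable T : choiceType.

Lemma size_leq_labels (L : eqType) (s : seq T) (l : seq L) (P : T -> L -> Prop) :
    uniq s -> (forall t, t \in s -> exists2 x, x \in l & P t x) ->
    (forall t u x, t \in s -> u \in s -> P t x -> P u x -> t = u) ->
  (size s <= size l)%N.
Proof.
move=> us sl Pinj; case: l sl => [|x0 l] sl.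
  by case: s us sl Pinj => // t s _ sl _; have [] := sl t (mem_head _ _).
have /boolp.choice [f fP] : forall t, exists x,
    t \in s -> x \in x0 :: l /\ P t x.
  move=> t; have [/sl [x xl Px]|ts] := boolP (t \in s).
    by exists x.
  by exists x0.
rewrite -(size_map f); apply: uniq_leq_size => [|_ /mapP [t ts ->]].
  rewrite map_inj_in_uniq // => t u ts us' e.
  apply: (Pinj _ _ (f t)) => //; first by case: (fP _ ts).
  by rewrite e; case: (fP _ us').
by case: (fP t ts).
Qed.

(** A duplicate-free list in [A] of maximal length exists by the bound, and it must exhaust [A]. *)
Lemma card_le_uniq (A : set T) N :
    (forall s : seq T, uniq s -> (forall t, t \in s -> A t) -> (size s <= N)%N) ->
  A #<= `I_N.
Proof.
move=> sN; pose P n := `[< exists s : seq T,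
  [/\ uniq s, forall t, t \in s -> A t & size s = n] >].
have P0 : exists n, P n by exists 0%N; apply/asboolP; exists [::]; split.
have PN n : P n -> (n <= N)%N by move=> /asboolP [s [us sA <-]]; apply: sN.
case: (ex_maxnP P0 PN) => n /asboolP [s [us sA sn]] nmax.
have As t : A t -> t \in s.
  move=> At; apply: contrapT => /negP ts.
  have /nmax : P n.+1.
    apply/asboolP; exists (t :: s); split=> /=; rewrite ?ts ?sn // => u.
    by rewrite inE => /predU1P [->|/sA].
  by rewrite ltnn.
case: s us sA sn As => [|t0 s] us sA sn As.
  suff -> : A = set0 by exact: card_ge0.
  by apply/seteqP; split=> // t /As.
have -> : A = nth t0 (t0 :: s) @` `I_n.
  apply/seteqP; split=> [t /As ts|_ [i /= ni <-]].
    by exists (index t (t0 :: s)); [rewrite -sn /= -index_mem in ts *|rewrite nth_index].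
  by apply: sA; rewrite mem_nth // sn.
apply: card_le_trans (card_image_le _ _) _.
by rewrite card_le_II PN //; apply/asboolP; exists (t0 :: s).
Qed.

End Counting.

(** * Affine points, infinity and fibers of the two projections *)

Section Points.
Variable k : closedFieldType.
Implicit Types (p : {poly {poly k}}) (x y a b : k) (z w : P1 k).

Lemma affine_neq0 a : (1, a) != (0, 0) :> k * k.
Proof. by rewrite xpair_eqE oner_eq0. Qed.

Lemma infinite_neq0 : (0, 1) != (0, 0) :> k * k.
Proof. by rewrite xpair_eqE oner_eq0 andbF. Qed.

Definition pt a : P1 k := \pi_(P1 k) (HCoord (affine_neq0 a)).
Definition infpt : P1 k := \pi_(P1 k) (HCoord infinite_neq0).

Lemma pt_inj : injective pt.
Proof.
move=> a b /eqP; rewrite eqmodE => /eqP /=; rewrite mul1r mulr1 => ->.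
by [].
Qed.

Lemma P1_cases z : z = infpt \/ exists a, z = pt a.
Proof.
rewrite -(reprK z); case: (repr z). move=> [x0 x1] nz.
have [x00|x0n] := eqVneq x0 0; [left|right; exists (x1 / x0)];
  apply/eqP; rewrite eqmodE; apply/eqP => /=.
- by rewrite x00 mul0r mulr0.
- by rewrite mulr1 mulrC divfK.
Qed.

Lemma curve_pt p x y : curve p (pt x, pt y) <-> (specX p x).[y] = 0.
Proof.
rewrite /pt curveE horner_specX /bihom /pairing /=.
have eq_iff0 (u v : k) : u = v -> (u = 0 <-> v = 0) by move=> ->.
apply: eq_iff0; apply: eq_bigr => i _; apply: eq_bigr => j _.
by rewrite !expr1n !mul1r.
Qed.

(** At x_0 = 0 only the terms of top degree in X remain. *)
Lemma curve_inf_pt p y : curve p (infpt, pt y) <-> (lead_coef p).[y] = 0.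
Proof.
rewrite /infpt /pt curveE /bihom /=.
have eq_iff0 (u v : k) : u = v -> (u = 0 <-> v = 0) by move=> ->.
apply: eq_iff0; rewrite lead_coefE (horner_coef_wide _ (size_coef_leq p _)).
rewrite big_ord_recr /= big1 ?add0r => [|i _].
  by apply: eq_bigr => j _; rewrite subnn !expr1n !mulr1 mul1r.
by rewrite big1 // => j _; rewrite expr0n subn_eq0 leqNgt ltn_ord !(mul0r, mulr0).
Qed.

(** Statements about the second projection reduce to the first through this symmetry. *)
Lemma curve_swapXY p z w : curve (swapXY p) (w, z) <-> curve p (z, w).
Proof.
rewrite /curve /bihom /= /deg_x /deg_y sizeYE swapXYK -sizeYE exchange_big.
have eq_iff0 (u v : k) : u = v -> (u = 0 <-> v = 0) by move=> ->.
apply: eq_iff0; apply: eq_bigr => i _; apply: eq_bigr => j _; rewrite coef_swapXY; ring.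
Qed.

Lemma irreducible_swapXY p : irreducible_elt p -> irreducible_elt (swapXY p).
Proof.
have swap_unit (q : {poly {poly k}}) :
    swapXY q \is a GRing.unit -> q \is a GRing.unit.
  by move=> u; rewrite -[q]swapXYK; apply: rmorph_unit.
move=> [p0 pu irr]; split; first by rewrite swapXY_eq0.
- by apply: contra pu => /swap_unit.
- move=> b c e; have e' : p = swapXY b * swapXY c by rewrite -[LHS]swapXYK e rmorphM.
  by case: (irr _ _ e') => /swap_unit; [left|right].
Qed.

Lemma in_kY_swapXY p : in_kY (swapXY p) -> in_kX p.
Proof.
by case=> q e; exists q; rewrite -[p]swapXYK e swapXY_polyC.
Qed.

Lemma in_kX_swapXY p : in_kX (swapXY p) -> in_kY p.
Proof.
by case=> q e; exists q; rewrite -[p]swapXYK e swapXY_map_polyC.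
Qed.

Lemma size_gt1 p : ~ in_kY p -> (1 < size p)%N.
Proof.
by move=> pY; rewrite ltnNge; apply/negP => /size1_polyC e; apply: pY; exists p`_0.
Qed.

(** Otherwise Y - y divides p, and irreducibility makes the cofactor a unit, so p would lie in
    k[Y]. *)
Lemma specY_neq0 p y : irreducible_elt p -> ~ in_kY p -> specY p y != 0.
Proof.
move=> [p0 _ irr] pY; apply/eqP => /slice_eq0_factor [g e].
rewrite -mul_polyC in e; case: (irr _ _ e); rewrite poly_unitE.
  by rewrite coefC eqxx poly_unitE size_XsubC andbF.
case/andP => /eqP sg _; have /size1_polyC eg : (size g <= 1)%N by rewrite sg.
by apply: pY; exists (('X - y%:P) * g`_0); rewrite e polyCM -eg.
Qed.

Lemma specX_neq0 p x : irreducible_elt p -> ~ in_kX p -> specX p x != 0.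
Proof.
move=> irr pX; apply: (@specY_neq0 (swapXY p)); first exact: irreducible_swapXY.
by move/in_kY_swapXY.
Qed.

(** The affine points of the fiber are roots of p(x, Y) or, over infinity, of the leading
    coefficient in X; infinity itself is always added to the list. *)
Lemma curve_fiber_finite p z : irreducible_elt p -> ~ in_kX p ->
  exists s : seq (P1 k), forall w, curve p (z, w) -> w \in s.
Proof.
move=> irr pX; suff [f f0 fP] : exists2 f : {poly k}, f != 0 &
    forall y, curve p (z, pt y) -> root f y.
  have [s es] := closed_field_poly_normal f; exists (infpt :: map pt s) => w.
  have [->|[y ->] /fP] := P1_cases w; first by rewrite mem_head.
  rewrite es rootZ ?lead_coef_eq0 // root_prod_XsubC => ys.
  by rewrite inE map_f ?orbT.
have [->|[x ->]] := P1_cases z.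
  exists (lead_coef p) => [|y /curve_inf_pt/rootP //].
  by case: irr; rewrite lead_coef_eq0.
exists (specX p x) => [|y /curve_pt/rootP //]; exact: specX_neq0.
Qed.

Lemma curve_cofiber_finite p w : irreducible_elt p -> ~ in_kY p ->
  exists s : seq (P1 k), forall z, curve p (z, w) -> z \in s.
Proof.
move=> irr pY.
have [||s sP] := @curve_fiber_finite (swapXY p) w; first exact: irreducible_swapXY.
  by move/in_kX_swapXY.
by exists s => z /curve_swapXY/sP.
Qed.

End Points.

(** * Finite orbits *)

Section Orbits.
Variables (T : Type) (C : set (T * T)).

Lemma orbit_sub z w : C z -> orbit_of C z w -> C w.
Proof.
have sub u v : clos_refl_sym_trans _ (same_coord C) u v -> (C u <-> C v).
  elim=> {u v} [u v [Cu Cv _]||u v _ [? ?]|u v t _ [uv vu] _ [vt tv]] //.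
  by split=> ?; [apply/vt/uv|apply/vu/tv].
by move=> Cz /sub [/(_ Cz)].
Qed.

Lemma orbit_eq z w : orbit_of C z w -> orbit_of C z = orbit_of C w.
Proof.
move=> zw; apply/seteqP; split=> u; last exact: rst_trans.
by apply: rst_trans; apply: rst_sym.
Qed.

(** Points of [C] sharing a coordinate are one step apart. Hence coordinates can label orbits in the
    count, and distinct orbits have disjoint coordinate sets. *)
Lemma orbits_coord_eq (O O' : set (T * T)) z w : orbits C O -> orbits C O' ->
  O z -> O' w -> z.1 = w.1 \/ z.2 = w.2 -> O = O'.
Proof.
move=> [z0 Cz0 <-] [w0 Cw0 <-] z0z w0w zw.
rewrite (orbit_eq z0z) (orbit_eq w0w); apply: orbit_eq; apply: rst_step.
by split=> //; [apply: orbit_sub z0z|apply: orbit_sub w0w].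
Qed.

Lemma orbits_coord_in (O : set (T * T)) z w : orbits C O -> O z -> C w ->
  z.1 = w.1 \/ z.2 = w.2 -> O w.
Proof.
move=> [z0 Cz0 <-] z0z Cw zw; apply: rst_trans (z0z) _; apply: rst_step.
by split=> //; apply: orbit_sub z0z.
Qed.

Lemma orbits_sub (O : set (T * T)) z : orbits C O -> O z -> C z.
Proof. by move=> [z0 Cz0 <-]; apply: orbit_sub. Qed.

Lemma orbits_nonempty (O : set (T * T)) : orbits C O -> exists z, O z.
Proof. by move=> [z Cz <-]; exists z; apply: rst_refl. Qed.

End Orbits.

(** * From unramified orbits to the bound *)

Section FiniteOrbits.
Variables (k : closedFieldType) (p : {poly {poly k}}).
Local Notation C := (curve p).
Local Notation specX := (specX p).
Local Notation specY := (specY p).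
Implicit Types (x y : k) (O : set (P1 k * P1 k)).

Definition unramified_orbit O : Prop := forall z, O z -> exists x y,
  [/\ z = (pt x, pt y), (specX x)^`().[y] != 0 & (specY y)^`().[x] != 0].

(** The coordinate sets of the orbit form the grid, since an orbit contains every curve point that
    shares a coordinate with one of its points. *)
Lemma unramified_orbit_grid O : finite_orbits C O -> unramified_orbit O ->
  exists A B, [/\ unramified_grid p A B, A != [::] &
    forall x, x \in A -> exists2 z, O z & z.1 = pt x].
Proof.
move=> [CO Ofin] unram.
have [s es] := (finite_seqP O).1 Ofin.
have Os (z : P1 k * P1 k) : O z <-> z \in s by rewrite es.
(* [f] inverts [pt]. Its value at infinity is arbitrary and harmless, because the points of the
   orbit are affine. *)
have /boolp.choice [f fP] : forall z : P1 k, exists x, forall x', z = pt x' -> x = x'.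
  move=> z; have [->|[x ->]] := P1_cases z; last by exists x => x' /pt_inj.
  exists 0 => x' /eqP; rewrite eqmodE => /eqP /=; rewrite mul0r mulr1.
  by move=> /eqP; rewrite eq_sym oner_eq0.
have fpt x : f (pt x) = x by apply: fP.
pose A := undup [seq f z.1 | z <- s]; pose B := undup [seq f z.2 | z <- s].
have inA x : x \in A <-> exists2 z, O z & z.1 = pt x.
  rewrite mem_undup; split=> [/mapP [z /Os Oz ->]|[z /Os zs e]].
    by exists z => //; have [x' [y' [-> _ _]]] := unram z Oz; rewrite /= fpt.
  by apply/mapP; exists z => //; rewrite e fpt.
have inB y : y \in B <-> exists2 z, O z & z.2 = pt y.
  rewrite mem_undup; split=> [/mapP [z /Os Oz ->]|[z /Os zs e]].
    by exists z => //; have [x' [y' [-> _ _]]] := unram z Oz; rewrite /= fpt.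
  by apply/mapP; exists z => //; rewrite e fpt.
have inAO x y : (specX x).[y] = 0 -> x \in A -> O (pt x, pt y).
  move=> /curve_pt Cxy /inA [z Oz ez].
  by apply: orbits_coord_in CO Oz Cxy _; left.
exists A, B; split; last by move=> x /inA.
- split; rewrite ?undup_uniq // => x y pxy.
    apply/idP/idP => [xA|/inB [z Oz ez]].
      by apply/inB; exists (pt x, pt y); first exact: inAO.
    apply/inA; exists (pt x, pt y) => //.
    by apply: orbits_coord_in CO Oz (_ : C _) _; [apply/curve_pt|right].
  move=> /(inAO _ _ pxy)/unram [x' [y' [[/pt_inj <- /pt_inj <-] ? ?]]] //.
- have [z Oz] := orbits_nonempty CO; have [x [y [ez _ _]]] := unram z Oz.
  have : x \in A by apply/inA; exists z => //; rewrite ez.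
  by case: (A).
Qed.

Hypothesis pchar0 : [pchar k] =i pred0.
Hypotheses (irr : irreducible_elt p) (pX : ~ in_kX p) (pY : ~ in_kY p).

Lemma ramified_columns : exists2 s : seq k, (size s <= 2 * deg_x p * deg_y p)%N &
  forall x y, (specX x).[y] = 0 -> (specY y)^`().[x] = 0 -> y \in s.
Proof.
have [s sB sP] := ramification_bound pchar0 irr (size_gt1 pY).
exists s => // x y pxy; apply: sP.
by apply/rootP; rewrite -/(specY y) -root_specX_specY; apply/rootP.
Qed.

Lemma ramified_rows : exists2 s : seq k, (size s <= 2 * deg_x p * deg_y p)%N &
  forall x y, (specX x).[y] = 0 -> (specX x)^`().[y] = 0 -> x \in s.
Proof.
have [||s sB sP] := @ramification_bound _ pchar0 (swapXY p).
- exact: irreducible_swapXY.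
- by apply: size_gt1 => /in_kY_swapXY.
exists s => [|x y]; last exact: sP.
by move: sB; rewrite /deg_x /deg_y sizeYE swapXYK -sizeYE -!mulnA (mulnC (_ p).-1).
Qed.

(** The two relations say that the vectors (u_c, u_d) at two points with a common image are
    proportional, outside a finite set. Proportionality classes have at most [D] points there, so
    [merged_classes_bounded] applies. *)
Lemma unramified_orbits_finite_corr r (O : 'I_r -> set (P1 k * P1 k)) :
    (deg_x p * deg_y p + 1 < r)%N -> injective O ->
    (forall i, finite_orbits C (O i)) -> (forall i, unramified_orbit (O i)) ->
  finite_corr C.
Proof.
move=> ltr injO finO unramO.
have [A /boolp.choice [B AB]] := boolp.choice
  (fun i => unramified_orbit_grid (finO i) (unramO i)).
have grid i : unramified_grid p (A i) (B i) by case: (AB i).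
have uA i : uniq (A i) by case: (grid i).
have nA i : A i != [::] by case: (AB i).
have dA i j a : a \in A i -> a \in A j -> i = j.
  have [[_ _ ai] [_ _ aj]] := (AB i, AB j).
  move=> /ai [z Oz ez] /aj [w Ow ew]; apply: injO.
  have [[Oi _] [Oj _]] := (finO i, finO j).
  by apply: orbits_coord_eq Oi Oj Oz Ow _; left; rewrite ez ew.
have [c [d [indep rel]]] := linear_relations ltr grid.
have [D zerosD] := partial_fraction_zeros uA nA dA.
pose u (e : 'I_r -> k) x := \sum_i e i * \sum_(a <- A i) (x - a)^-1.
pose v (e : 'I_r -> k) y := \sum_i e i * \sum_(b <- B i) (y - b)^-1.
have c0 : exists i, c i != 0.
  apply: contrapT => no; have [|/eqP] := indep 1 0; last by rewrite oner_eq0.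
  move=> i; rewrite mul0r addr0 mul1r; apply/eqP; apply: contrapT => /negP ci.
  by apply: no; exists i.
(* Excluding the zeros of u_c keeps the vector (u_c, u_d) from vanishing. *)
have [Z _ ZP] := zerosD c c0.
have [rx _ rxP] := ramified_rows; have [ry _ ryP] := ramified_columns.
pose flat (S : 'I_r -> seq k) := flatten [seq S i | i <- enum 'I_r].
have inflat S i a : a \in S i -> a \in flat S.
  by move=> aS; apply/flattenP; exists (S i) => //; apply: map_f; rewrite mem_enum.
have /boolp.choice [fib fibP] : forall w, exists s : seq (P1 k),
    forall z, C (z, w) -> z \in s by move=> w; apply: curve_cofiber_finite.
have /boolp.choice [cofib cofibP] : forall z, exists s : seq (P1 k),
    forall w, C (z, w) -> w \in s by move=> z; apply: curve_fiber_finite.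
(* The relations are usable only at affine unramified points off the grids. [Y] collects the bad
   second coordinates, and [E] the bad first coordinates together with the fibers over [Y]. *)
pose Y := infpt k :: map (@pt k) (flat B ++ ry).
pose E := (infpt k :: map (@pt k) (flat A ++ rx ++ Z)) ++ flatten (map fib Y).
have notE z : z \notin E -> exists x, [/\ z = pt x, forall i, x \notin A i,
    x \notin rx, x \notin Z & forall w, C (z, w) -> w \notin Y].
  rewrite mem_cat negb_or inE negb_or => /andP [/andP [zinf zpt] zY].
  have [zi|[x ex]] := P1_cases z; first by rewrite zi eqxx in zinf.
  have : x \notin flat A ++ rx ++ Z.
    by apply: contra zpt => xs; rewrite ex map_f.
  rewrite !mem_cat !negb_or => /and3P [xA xrx xZ]; exists x; split=> //.
    by move=> i; apply: contra xA; apply: inflat.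
  move=> w Czw; apply: contra zY => wY; apply/flattenP; exists (fib w).
    exact: map_f.
  exact: fibP.
(* Equality of u_c/u_d, stated as proportionality because u_d may vanish. *)
pose eqv z z' := exists x x' q, [/\ z = pt x, z' = pt x', q != 0,
  u c x' = q * u c x & u d x' = q * u d x].
pose R := mv_comp (tr_corr C) (corr C).
have RP z z' : R z z' <-> exists w, C (z, w) /\ C (z', w).
  split=> [[w [[z1 w1] [Czw /= ez] /= ew]] [[z2 w2] [Czw' /= ew'] /= ez']|].
    by exists w; subst.
  by case=> w [Czw Czw']; exists w; [exists (z, w)|exists (z', w)].
have [N stab] : exists N, forall z, mv_iter N.+1 R z = mv_iter N.+2 R z.
  apply: (@merged_classes_bounded _ R _ eqv E D).
  - by move=> z z' /RP [w [Czw Cz'w]]; split; apply/RP; exists w.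
  - move=> z /notE [x [-> _ _ _ _]]; exists x, x, 1.
    by rewrite !mul1r oner_eq0.
  - move=> z1 z2 z3 [x1 [x2 [q [-> -> q0 ec ed]]]].
    move=> [x2' [x3 [q' [/pt_inj <- -> q'0 ec' ed']]]].
    by exists x1, x3, (q' * q); rewrite mulf_neq0 // -!mulrA -ec -ed.
  - move=> z z' /notE [x [-> xA xrx _ zY]] /notE [x' [-> x'A x'rx _ z'Y]].
    move=> /RP [w [Czw Cz'w]]; move: Czw Cz'w (zY w Czw).
    have [->|[y ->]] := P1_cases w; first by move=> _ _; rewrite mem_head.
    move=> /curve_pt pxy /curve_pt px'y; rewrite inE negb_or => /andP [_ yY].
    have : y \notin flat B ++ ry by apply: contra yY; apply: map_f.
    rewrite mem_cat negb_or => /andP [yflat yry].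
    have yB i : y \notin B i by apply: contra yflat; apply: inflat.
    have al : (specX x)^`().[y] != 0.
      by apply: contra xrx => /eqP; apply: rxP.
    have al' : (specX x')^`().[y] != 0.
      by apply: contra x'rx => /eqP; apply: rxP.
    have be : (specY y)^`().[x] != 0.
      by apply: contra yry => /eqP; apply: ryP.
    have be' : (specY y)^`().[x'] != 0.
      by apply: contra yry => /eqP; apply: ryP px'y.
    (* Eliminating v(y) from the relations at (x, y) and (x', y) gives this factor, the same for [c]
       and [d]. *)
    pose q := ((specY y)^`().[x'] * (specX x)^`().[y]) /
              ((specX x')^`().[y] * (specY y)^`().[x]).
    have prop e : e = c \/ e = d -> u e x' = q * u e x.
      move=> ecd; have r1 := rel x y pxy xA yB e ecd.
      have r2 := rel x' y px'y x'A yB e ecd.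
      apply: (mulfI al'); apply: (mulfI be); rewrite /q.
      rewrite -/(u e x) -/(v e y) in r1; rewrite -/(u e x') -/(v e y) in r2.
      move/eqP: r1; rewrite addr_eq0 => /eqP r1.
      move/eqP: r2; rewrite addr_eq0 => /eqP r2.
      transitivity ((specY y)^`().[x'] * ((specX x)^`().[y] * u e x)).
        by rewrite r1 r2; ring.
      by field; rewrite al' be.
    exists x, x', q; split=> //.
    + by rewrite mulf_neq0 ?invr_eq0 ?mulf_neq0.
    + by apply: prop; left.
    + by apply: prop; right.
  - move=> z /notE [x [-> xA _ xZ _]].
    have ucx : u c x != 0 by apply: contra xZ => /eqP; apply: ZP.
    (* The class of x lies among the zeros of u_d(x) u_c - u_c(x) u_d. This combination is
       nontrivial because u_c(x) is nonzero and [c], [d] are independent. *)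
    have [|s sD sP] := zerosD (fun i => u d x * c i - u c x * d i).
      apply: contrapT => no; have [|_ /eqP] := indep (u d x) (- u c x).
        move=> i; rewrite mulNr; apply/eqP; apply: contrapT => /negP nz.
        by apply: no; exists i.
      by rewrite oppr_eq0 (negPf ucx).
    exists (map (@pt k) s); first by rewrite size_map.
    move=> z' /notE [x' [-> x'A _ _ _]] [_ [_ [q [/pt_inj <- /pt_inj <- q0 ec ed]]]].
    apply: map_f; apply: sP => //.
    transitivity (u d x * u c x' - u c x * u d x').
      rewrite /u !mulr_sumr -sumrB; apply: eq_bigr => i _.
      by rewrite mulrBl !mulrA.
    by rewrite ec ed; ring.
  - move=> e; exists (flatten (map fib (cofib e))) => z /RP [w [Cew Czw]].
    by apply/flattenP; exists (fib w); [apply/map_f/cofibP|apply: fibP].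
by exists N.+1.
Qed.

(** An orbit that meets infinity or a ramification point is labelled by a bad first or second
    coordinate, with at most 2mn + 1 labels of each kind. The other orbits are unramified, and mn +
    2 of them would make the correspondence finite. *)
Lemma finite_orbits_bound :
  ~ finite_corr C ->
  finite_orbits C #<= `I_((2 * deg_x p * deg_y p).+1 + (2 * deg_x p * deg_y p).+1
                          + (deg_x p * deg_y p + 1)).
Proof.
move=> infC; apply: card_le_uniq => s us sO.
have [rx rxB rxP] := ramified_rows; have [ry ryB ryP] := ramified_columns.
pose onX O := `[< exists2 z, O z & z.1 \in infpt k :: map (@pt k) rx >].
pose onY O := `[< exists2 z, O z & z.2 \in infpt k :: map (@pt k) ry >].
pose s' := filter (predC onX) s.
rewrite -(count_predC onX s) -!size_filter -/s'.
rewrite -(count_predC onY s') -!size_filter addnA.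
have orb O : O \in s -> orbits C O by move=> /sO [].
apply: leq_add; first apply: leq_add.
- have := @size_leq_labels _ _ (filter onX s) (infpt k :: map (@pt k) rx)
    (fun O (t : P1 k) => exists2 z, O z & z.1 = t).
  rewrite /= size_map => h; apply: leq_trans (h _ _ _) _.
  + exact: filter_uniq.
  + move=> O; rewrite mem_filter => /andP [/asboolP [z Oz zx] _].
    by exists z.1 => //; exists z.
  + move=> O O' t; rewrite !mem_filter => /andP [_ sO1] /andP [_ sO2].
    move=> [z Oz ez] [w Ow ew].
    by apply: orbits_coord_eq (orb _ sO1) (orb _ sO2) Oz Ow _; left; rewrite ez ew.
  + by rewrite ltnS.
- have := @size_leq_labels _ _ (filter onY s') (infpt k :: map (@pt k) ry)
    (fun O (t : P1 k) => exists2 z, O z & z.2 = t).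
  rewrite /= size_map => h; apply: leq_trans (h _ _ _) _.
  + by do 2!apply: filter_uniq.
  + move=> O; rewrite mem_filter => /andP [/asboolP [z Oz zy] _].
    by exists z.2 => //; exists z.
  + move=> O O' t; rewrite !mem_filter => /and3P [_ _ sO1] /and3P [_ _ sO2].
    move=> [z Oz ez] [w Ow ew].
    by apply: orbits_coord_eq (orb _ sO1) (orb _ sO2) Oz Ow _; right; rewrite ez ew.
  + by rewrite ltnS.
- set s2 := filter _ s'; rewrite leqNgt; apply/negP => lt_s2; apply: infC.
  have us2 : uniq s2 by do 2!apply: filter_uniq.
  have mem2 (i : 'I_(size s2)) : nth set0 s2 i \in s2 by rewrite mem_nth.
  apply: (@unramified_orbits_finite_corr (size s2) (fun i => nth set0 s2 i)) => //.
  + by move=> i j /eqP; rewrite nth_uniq // => /eqP /val_inj.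
  + by move=> i; have := mem2 i; rewrite !mem_filter => /and3P [_ _ /sO].
  + move=> i z Oz; have := mem2 i; rewrite !mem_filter.
    move=> /and3P [/asboolP nY /asboolP nX si].
    have Cz := orbits_sub (orb _ si) Oz.
    case: z Oz Cz => [z w] Oz Cz.
    have [ez|[x ex]] := P1_cases z.
      by case: nX; exists (z, w) => //=; rewrite ez mem_head.
    have [ew|[y ey]] := P1_cases w.
      by case: nY; exists (z, w) => //=; rewrite ew mem_head.
    have pxy : (specX x).[y] = 0 by apply/curve_pt; rewrite -ex -ey.
    exists x, y; split; first by rewrite ex ey.
    * apply/eqP => dx0; apply: nX; exists (z, w) => //=.
      by rewrite inE ex map_f ?orbT //; apply: rxP dx0.
    * apply/eqP => dy0; apply: nY; exists (z, w) => //=.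
      by rewrite inE ey map_f ?orbT //; apply: ryP dy0.
Qed.
End FiniteOrbits.

Theorem theorem2 (k : closedFieldType) (hk : [pchar k] =i pred0) :
  (forall p : {poly {poly k}},
     irreducible_elt p -> ~ in_kX p -> ~ in_kY p ->
     normal_curve p -> ~ finite_corr (curve p) ->
     finite_set (finite_orbits (curve p))) /\
  (exists B : nat -> nat -> nat,
     forall p : {poly {poly k}},
       irreducible_elt p -> ~ in_kX p -> ~ in_kY p ->
       normal_curve p -> ~ finite_corr (curve p) ->
       finite_orbits (curve p) #<= `I_(B (deg_x p) (deg_y p))).
Proof.
split=> [p irr pX pY _ infC|].
  apply/finite_set_leP; eexists; exact: finite_orbits_bound hk irr pX pY infC.
(* The bound is 5mn + 3. *)
exists (fun m n => (2 * m * n).+1 + (2 * m * n).+1 + (m * n + 1))%N.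
by move=> p irr pX pY _ infC; apply: finite_orbits_bound.
Qed.
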